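(* Let $f,g\in\mathbb{C}[x]$ be nonzero polynomials with $\deg f<\deg g<2\deg f+1$. Then the Liénard dynamical system $x_t=y$, $y_t=-f(x)y-g(x)$ (with these fixed coefficients of $f$ and $g$) has at most two distinct irreducible invariant algebraic curves simultaneously.
   Context: A polynomial $F\in\mathbb{C}[x,y]\setminus\mathbb{C}$ is an invariant algebraic curve of the Liénard system if $yF_x-\{f(x)y+g(x)\}F_y=\lambda(x,y)F$ for some $\lambda\in\mathbb{C}[x,y]$. It is irreducible if $F$ is irreducible in $\mathbb{C}[x,y]$. $F$ and $cF$ with $c\in\mathbb{C}\setminus\{0\}$ are identified. *)

(* Defs.v *)
From HB Require Import structures.
From mathcomp Require Import all_boot all_order all_algebra.
From mathcomp Require Import complex reals.

Set Implicit Arguments.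
Unset Strict Implicit.
Unset Printing Implicit Defensive.

Import Order.TTheory GRing.Theory Num.Theory.

Local Open Scope ring_scope.

(* C[x,y] is {poly {poly K}}: the inner variable is x and the outer one is y.
   Thus p : {poly K} is embedded as p%:P, and c : K as c%:P%:P. *)

(* For p = 0 this is 0; it is only applied to nonzero polynomials. *)
Definition deg (K : nzSemiRingType) (p : {poly K}) : nat := (size p).-1.

Definition partial_x (K : nzRingType) (F : {poly {poly K}}) : {poly {poly K}} :=
  map_poly (@deriv K) F.

Definition partial_y (K : nzRingType) (F : {poly {poly K}}) : {poly {poly K}} :=
  F^`().

Definition nonconstant (K : nzRingType) (F : {poly {poly K}}) : Prop :=
  forall c : K, F <> c%:P%:P.

Definition invariant_curve (K : nzRingType) (f g : {poly K})
    (F : {poly {poly K}}) : Prop :=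
  nonconstant F /\
  exists lambda : {poly {poly K}},
    'X * partial_x F - (f%:P * 'X + g%:P) * partial_y F = lambda * F.

(* Irreducibility in the ring D. The library's irreducible_poly is not suitable
   here: it relies on pseudo-division, so on {poly {poly K}} it ignores
   factors lying in K[x]. *)
Definition irreducible_elt (D : idomainType) (a : D) : Prop :=
  [/\ a != 0, a \isn't a GRing.unit &
      forall b c : D, a = b * c ->
        b \is a GRing.unit \/ c \is a GRing.unit].

Definition irreducible_invariant_curve (K : idomainType) (f g : {poly K})
    (F : {poly {poly K}}) : Prop :=
  invariant_curve f g F /\ irreducible_elt F.

Definition same_curve (K : nzRingType) (F G : {poly {poly K}}) : Prop :=
  exists2 c : K, c != 0 & F = c%:P%:P * G.

(* Main.v *)
Require Import Defs.
From HB Require Import structures.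
From mathcomp Require Import all_boot all_order all_algebra.
From mathcomp Require Import complex reals.
From mathcomp Require Import ring zify.

(** Write D = y d/dx - (f y + g) d/dy.  An invariant curve F has constant
    leading coefficient in y and a cofactor l_F in K[x]
    ([monic_representative]), so F may be taken monic in y.  Its roots a(x),
    algebraic over K(x), then satisfy a a' + f a + g = 0, and comparing the
    factors y - a gives l_F = sum of g / a.  If b is a root of another
    invariant curve G, subtracting the two equations gives
    (a - b)' / (a - b) = g / (a b).  Summing over all pairs of roots, the
    resultant r of F and G with respect to y satisfies

      g r' = l_F l_G r.

    Distinct monic irreducible curves have r <> 0, so comparing degrees in x
    gives deg l_F + deg l_G = deg g - 1 ([cofactor_size_pair]).

    On the other hand deg l_F is either at least deg f or equal to
    deg g - deg f - 1 ([cofactor_size_cases]).  When deg g < 2 deg f + 1, two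
    cofactors of the first kind have degrees that add up to more than
    deg g - 1, and two of the second kind to less.  Hence no two of the curves
    are of the same kind, and there are at most two.

    The differential equation for r is proved without adjoining roots
    ([resultant_ode]).  In the free K[x]-module A = K[x][y]/(F) the resultant
    is, up to sign, the determinant of the matrix M of multiplication by G.
    The operator D acts on A because F is invariant, and D (G p) =
    l_G G p + G D p says that, with C the matrix of multiplication by y,

      M' C + M L = l_G M + L M

    for some matrix L.  Multiplying by the adjugates of M and C and taking the
    trace turns M' into (det M)' by Jacobi's formula, and the terms in L
    cancel.  What remains of C is det C and the trace of its adjugate, which
    are the two lowest coefficients of F up to sign; their ratio is
    -l_F / g by the invariance of F. *)

Set Implicit Arguments.
Unset Strict Implicit.
Unset Printing Implicit Defensive.

Import Order.TTheory GRing.Theory Num.Theory.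

Local Open Scope ring_scope.

(** * Derivatives of determinants *)

Lemma deriv_prod (R : comNzRingType) n (u : 'I_n -> {poly R}) :
  (\prod_i u i)^`() = \sum_k \prod_i (if i == k then (u i)^`() else u i).
Proof.
elim: n u => [|n IHn] u; first by rewrite !big_ord0 derivC.
rewrite big_ord_recl derivM IHn big_ord_recl; congr (_ + _).
  by rewrite [RHS]big_ord_recl eqxx.
rewrite mulr_sumr; apply: eq_bigr => k _; rewrite [RHS]big_ord_recl.
by rewrite (negPf (neq_lift _ _)); congr (_ * _); apply: eq_bigr.
Qed.

(** Jacobi's formula: deriving the k-th factor of each term of the Leibniz
    expansion amounts to deriving the k-th row of [M], and expanding the result
    along that row pairs it with the cofactors of [M]. *)
Lemma deriv_det (R : comNzRingType) n (M : 'M[{poly R}]_n) :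
  (\det M)^`() = \tr (\adj M *m map_mx (@deriv R) M).
Proof.
rewrite /determinant raddf_sum /= mxtrace_mulC.
pose N k : 'M_n := \matrix_(i, j) if i == k then (M i j)^`() else M i j.
have -> : \tr (map_mx (@deriv R) M *m \adj M) = \sum_k \det (N k).
  apply: eq_bigr => k _; rewrite (expand_det_row _ k) mxE.
  apply: eq_bigr => j _; rewrite !mxE eqxx; congr (_ * (_ * \det _)).
  by apply/matrixP=> i l; rewrite !mxE eq_sym (negPf (neq_lift _ _)).
rewrite exchange_big /=; apply: eq_bigr => s _.
have signE k (p : {poly R}) : ((-1) ^+ k * p)^`() = (-1) ^+ k * p^`().
  by rewrite -(rmorph_sign (@polyC R)) deriv_mulC.
rewrite -mulr_sumr signE deriv_prod; congr (_ * _).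
by apply: eq_bigr => k _; apply: eq_bigr => i _; rewrite mxE.
Qed.

(** * The quotient by a monic polynomial *)

Section Mod.
Import Pdiv.CommonRing Pdiv.RingMonic.
Variables (A : comNzRingType) (F : {poly A}).
Hypothesis monF : F \is monic.
Local Notation d := (size F).-1.

Definition modrow (p : {poly A}) : 'rV[A]_d := poly_rV (rmodp p F).
Definition mulmod_mx (G : {poly A}) : 'M[A]_d :=
  \matrix_(i < d) modrow (G * 'X^i).

Lemma modrow_linear : linear modrow.
Proof.
move=> a p q; rewrite /modrow rmodpD // rmodpZ //; exact: linearP.
Qed.
HB.instance Definition _ :=
  GRing.isLinear.Build A {poly A} 'rV[A]_d _ modrow modrow_linear.

Lemma modrow_mull p : modrow (p * F) = 0.
Proof. by rewrite /modrow rmodp_mull // linear0. Qed.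

Lemma size_rmodp_monic p : (size (rmodp p F) <= d)%N.
Proof.
have := ltn_rmodpN0 p (monic_neq0 monF).
by case: (size F) => // n; rewrite ltnS.
Qed.

Lemma rVpolyE (v : 'rV[A]_d) : rVpoly v = \sum_i v 0 i *: 'X^i.
Proof.
by rewrite /rVpoly poly_def; apply: eq_bigr => i _; rewrite valK.
Qed.

(** The form in which reduction modulo [F] is used: an additive operator that
    preserves the ideal of [F] is determined, on classes, by its values on
    multiples of the powers of the variable below the degree of [F]. *)
Lemma modrow_eq p : exists q, p = q * F + \sum_i modrow p 0 i *: 'X^i.
Proof.
exists (rdivp p F).
by rewrite -rVpolyE poly_rV_K ?size_rmodp_monic // -rdivp_eq.
Qed.

Lemma modrow_mul G p : modrow (G * p) = modrow p *m mulmod_mx G.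
Proof.
have [q {1}->] := modrow_eq p.
rewrite mulrDr mulrA linearD /= modrow_mull add0r mulr_sumr linear_sum /=.
rewrite mulmx_sum_row; apply: eq_bigr => i _.
by rewrite rowK -scalerAr linearZ.
Qed.

Lemma mulmod_mxM G H : mulmod_mx (G * H) = mulmod_mx G *m mulmod_mx H.
Proof.
by apply/row_matrixP => i; rewrite row_mul !rowK -modrow_mul mulrCA mulrA.
Qed.

Lemma modrow_small (p : {poly A}) : (size p <= d)%N -> modrow p = poly_rV p.
Proof.
move=> szp; rewrite /modrow rmodp_small //.
by rewrite (leq_ltn_trans szp) // ltn_predL size_poly_gt0 monic_neq0.
Qed.

Lemma mulmod_mxC c : mulmod_mx c%:P = c%:M.
Proof.
apply/row_matrixP => i; rewrite !rowK mul_polyC linearZ /=.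
rewrite modrow_small; last by rewrite size_polyXn.
by apply/rowP => j; rewrite !mxE coefXn eq_sym mulr_natr.
Qed.

Lemma mulmod_mxD G H : mulmod_mx (G + H) = mulmod_mx G + mulmod_mx H.
Proof. by apply/row_matrixP => i; rewrite linearD /= !rowK mulrDl linearD. Qed.

Lemma mulmod_mx_mull G : mulmod_mx (G * F) = 0.
Proof. by apply/row_matrixP => i; rewrite linear0 rowK mulrAC modrow_mull. Qed.

Lemma mulmod_mxX : mulmod_mx 'X = companionmx F.
Proof.
apply/row_matrixP => i; rewrite !rowK -exprS.
have lt_id := ltn_ord i.
have [ltid|leid] := ltnP i.+1 d.
  rewrite modrow_small ?size_polyXn //; apply/rowP => j.
  by rewrite !mxE coefXn eq_sym (ltn_eqF (_ : (i < d.-1)%N)) //; lia.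
have eqd : i.+1 = d by lia.
have -> : 'X^(i.+1) = 1 * F + ('X^d - F) by rewrite mul1r addrC subrK eqd.
rewrite linearD /= modrow_mull add0r modrow_small; last first.
  apply/leq_sizeP => j lej; rewrite coefB coefXn.
  have [->|neq] := eqVneq j d.
    by rewrite -[F`_ _]/(lead_coef F) (monicP monF) subrr.
  rewrite nth_default ?subr0 //; move: lej neq.
  by rewrite leq_eqVlt eq_sym => /orP[->//|]; case: (size F).
apply/rowP => j; rewrite !mxE coefB coefXn (ltn_eqF (ltn_ord j)) sub0r.
by have /= /eqP -> := congr1 predn eqd.
Qed.

End Mod.

(** Multiplication by [G] has multiplication by [v] as an inverse up to the
    nonzero scalar [r], because [u * F] vanishes in the quotient. *)
Lemma det_mulmod_coprime (A : idomainType) (F G u v : {poly A}) (r : A) :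
  F \is monic -> r != 0 -> r%:P = u * F + v * G ->
  \det (mulmod_mx F G) != 0.
Proof.
move=> monF r0 e; apply: contra_neq (expf_neq0 (size F).-1 r0) => detG.
rewrite -det_scalar -mulmod_mxC // e mulmod_mxD // mulmod_mx_mull // add0r.
by rewrite mulmod_mxM // det_mulmx detG mulr0.
Qed.

(** The coefficients of [F] of index 0 and 1 are found in its companion matrix
    by evaluating det('X - C) and its derivative at 0. *)

Section CharPoly.
Variables (A : comNzRingType) (F : {poly A}).
Hypothesis monF : F \is monic.

Lemma eval0_char_poly_mx n (C : 'M[A]_n) :
  map_mx (horner_eval 0) (char_poly_mx C) = - C.
Proof.
apply/matrixP => i j; rewrite !mxE /horner_eval hornerD hornerN hornerC.
by rewrite hornerMn hornerX mul0rn sub0r.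
Qed.

Lemma det_opp_companion : \det (- companionmx F) = F`_0.
Proof.
rewrite -eval0_char_poly_mx det_map_mx -/(char_poly _) companionmxK //.
by rewrite /= /horner_eval horner_coef0.
Qed.

Lemma tr_adj_opp_companion : \tr (\adj (- companionmx F)) = F`_1.
Proof.
rewrite -eval0_char_poly_mx -map_mx_adj trace_map_mx.
have : map_mx (@deriv A) (char_poly_mx (companionmx F)) = 1%:M.
  by apply/matrixP => i j; rewrite !mxE derivB derivC derivMn derivX subr0.
move=> e; have := deriv_det (char_poly_mx (companionmx F)).
rewrite e mulmx1 -/(char_poly _) companionmxK // => <-.
by rewrite /= /horner_eval horner_coef0 coef_deriv mulr1n.
Qed.

End CharPoly.

(** * The vector field acting on the quotient *)

Section Lienard.
Variables (K : comNzRingType) (f g : {poly K}).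
Implicit Types F G P Q : {poly {poly K}}.

Definition lienard_op P : {poly {poly K}} :=
  'X * partial_x P - (f%:P * 'X + g%:P) * partial_y P.

Lemma partial_xM P Q : partial_x (P * Q) = partial_x P * Q + P * partial_x Q.
Proof.
apply/polyP => k; rewrite coefD coef_map /= !coefM raddf_sum /= -big_split /=.
by apply: eq_bigr => i _; rewrite derivM !coef_map.
Qed.

Lemma lienard_op_is_additive : additive lienard_op.
Proof.
by move=> P Q; rewrite /lienard_op /partial_x /partial_y !raddfB /=; ring.
Qed.
HB.instance Definition _ := GRing.isAdditive.Build
  {poly {poly K}} {poly {poly K}} lienard_op lienard_op_is_additive.

Lemma lienard_opD P Q : lienard_op (P + Q) = lienard_op P + lienard_op Q.
Proof. exact: raddfD. Qed.

Lemma lienard_op_sum n (P : 'I_n -> {poly {poly K}}) :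
  lienard_op (\sum_i P i) = \sum_i lienard_op (P i).
Proof. exact: raddf_sum. Qed.

Lemma lienard_opM P Q :
  lienard_op (P * Q) = lienard_op P * Q + P * lienard_op Q.
Proof. by rewrite /lienard_op partial_xM /partial_y derivM; ring. Qed.

Lemma lienard_opC (c : {poly K}) : lienard_op c%:P = 'X * c^`()%:P.
Proof.
by rewrite /lienard_op /partial_x /partial_y map_polyC derivC mulr0 subr0.
Qed.

Definition lienard_mx F : 'M[{poly K}]_((size F).-1) :=
  \matrix_i modrow F (lienard_op 'X^i).

(** [lienard_op f g] is additive but not linear: it differentiates the
    coordinates and multiplies them by the outer variable, hence the term in
    [mulmod_mx F 'X].  It preserves the ideal of [F] since [F] is invariant. *)
Lemma modrow_lienard_op F l P : F \is monic -> lienard_op F = l * F ->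
  modrow F (lienard_op P) =
    map_mx (@deriv K) (modrow F P) *m mulmod_mx F 'X
    + modrow F P *m lienard_mx F.
Proof.
move=> monF invF; have [q eP] := modrow_eq monF P.
rewrite {1}eP lienard_opD lienard_opM invF (mulrCA q) mulrA -mulrDl.
rewrite linearD /= modrow_mull // add0r lienard_op_sum linear_sum /=.
rewrite !mulmx_sum_row -big_split /=; apply: eq_bigr => i _.
rewrite -mul_polyC lienard_opM lienard_opC linearD /= mul_polyC linearZ /=.
by rewrite [map_mx _ _ _ _]mxE !rowK mulrAC [_ * _%:P]mulrC mul_polyC linearZ.
Qed.

(** Both sides are matrices of the operator that sends [P] to
    [lienard_op f g (G * P)], the right-hand side after the Leibniz rule. *)
Lemma mulmod_mx_lienard F G lF (l : {poly K}) : F \is monic ->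
  lienard_op F = lF * F -> lienard_op G = l%:P * G ->
  map_mx (@deriv K) (mulmod_mx F G) *m companionmx F
  + mulmod_mx F G *m lienard_mx F
  = l *: mulmod_mx F G + lienard_mx F *m mulmod_mx F G.
Proof.
move=> monF invF invG; rewrite -mulmod_mxX //; apply/row_matrixP => i.
rewrite !linearD /= !row_mul linearZ /= -map_row !rowK.
rewrite -(modrow_lienard_op _ monF invF) lienard_opM invG linearD /=.
by rewrite -(modrow_mul monF G (lienard_op 'X^i)) -mulrA mul_polyC linearZ.
Qed.

End Lienard.

(** * The differential equation of the resultant *)

Lemma comm_adj (A : idomainType) n (M C : 'M[A]_n) :
  \det C != 0 -> M *m C = C *m M -> M *m \adj C = \adj C *m M.
Proof.
move=> detC comm; apply: (scalemx_inj detC).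
rewrite -mul_scalar_mx -mul_adj_mx -!mulmxA (mulmxA C) -comm -mulmxA.
by rewrite mul_mx_adj mul_mx_scalar -scalemxAr.
Qed.

Lemma coef0_lienard_op (K : comNzRingType) (f g : {poly K}) P :
  (lienard_op f g P)`_0 = - (g * P`_1).
Proof.
rewrite /lienard_op coefB coefXM mulrDl coefD -mulrA !coefCM.
by rewrite coefXM /= mulr0 !add0r coef_deriv mulr1n.
Qed.

(** Multiply the matrix equation by the inverse of [M] on the left and that of
    [C] on the right, and take traces: the two terms in [D] have the same trace
    because [M] and [C] commute, and Jacobi's formula recognises (det M)' in
    the first term.  Adjugates replace inverses so that [M] may be singular. *)
Lemma scaled_log_deriv_det (K : idomainType) n (M C D : 'M[{poly K}]_n) l :
  \det C != 0 -> M *m C = C *m M ->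
  map_mx (@deriv K) M *m C + M *m D = l *: M + D *m M ->
  \det C * (\det M)^`() = l * \tr (\adj C) * \det M.
Proof.
move=> detC comm /(congr1 (fun N => \tr (\adj M *m N *m \adj C))).
rewrite !mulmxDr !mulmxDl !mxtraceD.
have -> : \tr (\adj M *m (map_mx (@deriv K) M *m C) *m \adj C)
          = \det C * (\det M)^`().
  by rewrite deriv_det -!mulmxA mul_mx_adj mul_mx_scalar -scalemxAr mxtraceZ.
have -> : \tr (\adj M *m (M *m D) *m \adj C) = \det M * \tr (D *m \adj C).
  by rewrite mulmxA mul_adj_mx mul_scalar_mx -scalemxAl mxtraceZ.
have -> : \tr (\adj M *m (D *m M) *m \adj C) = \det M * \tr (D *m \adj C).
  rewrite -!mulmxA comm_adj // !mulmxA mxtrace_mulC !mulmxA mul_mx_adj.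
  by rewrite mul_scalar_mx -scalemxAl mxtraceZ.
have -> : \tr (\adj M *m (l *: M) *m \adj C) = l * \tr (\adj C) * \det M.
  rewrite -scalemxAr mul_adj_mx scale_scalar_mx mul_scalar_mx mxtraceZ.
  by rewrite mulrAC.
by move/addIr.
Qed.

(** The logarithmic derivative of [r] given by [scaled_log_deriv_det] is
    - lG F_1 / F_0, and the coefficient of y^0 in the invariance equation of [F]
    turns F_1 / F_0 into - lF / g. *)
Lemma resultant_ode (K : idomainType) (f g : {poly K})
    (F G : {poly {poly K}}) lF lG :
  F \is monic -> F`_0 != 0 ->
  lienard_op f g F = lF%:P * F -> lienard_op f g G = lG%:P * G ->
  let r := \det (mulmod_mx F G) in g * r^`() = lF * lG * r.
Proof.
move=> monF F0 invF invG r.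
have := mulmod_mx_lienard monF invF invG.
set M := mulmod_mx F G; set D := lienard_mx _ _ _; set C := companionmx F.
move=> e.
have oppe : map_mx (@deriv K) M *m (- C) + M *m (- D)
            = (- lG) *: M + (- D) *m M.
  by rewrite !mulmxN mulNmx -opprD e scaleNr opprD.
have comm : M *m (- C) = - C *m M.
  rewrite mulmxN mulNmx /C -mulmod_mxX // -!mulmod_mxM //.
  by rewrite mulrC.
(* The sign is moved to C because det(- C) and tr(adj(- C)) are exactly
   coefficients of F. *)
have := scaled_log_deriv_det _ comm oppe.
rewrite /C det_opp_companion // tr_adj_opp_companion // => /(_ F0) er.
have ec : lF * F`_0 = - (g * F`_1).
  have := congr1 (fun P : {poly {poly K}} => P`_0) invF.
  by rewrite coefCM coef0_lienard_op => <-.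
apply: (mulfI F0); rewrite mulrCA er.
transitivity (- (g * F`_1) * lG * r); first by rewrite -/M -/r; ring.
by rewrite -ec; ring.
Qed.

(** * Polynomials over a field of characteristic zero *)

Lemma size_deriv (K : numFieldType) (p : {poly K}) :
  size p^`() = (size p).-1.
Proof.
have [lep1|lt1p] := leqP (size p) 1.
  rewrite {1}[p]size1_polyC // derivC size_poly0.
  by case: (size p) lep1 => [|[]].
have p0 : p != 0 by rewrite -size_poly_gt0 ltnW.
have [n e] : exists n, size p = n.+2 by exists (size p).-2; lia.
rewrite e; apply/eqP; rewrite eqn_leq -ltnS -e lt_size_deriv //= e ltnNge.
apply/negP => /leq_sizeP/(_ n (leqnn n))/eqP; rewrite coef_deriv mulrn_eq0 /=.
by rewrite -[n.+1]/(n.+2.-1) -e -lead_coefE lead_coef_eq0 (negPf p0).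
Qed.

Lemma size_mulS (K : numFieldType) (p q : {poly K}) :
  p != 0 -> q != 0 -> (size (p * q)).+1 = (size p + size q)%N.
Proof.
by move=> p0 q0; rewrite size_mul // prednK // addn_gt0 size_poly_gt0 p0.
Qed.

(** * Irreducible bivariate polynomials and coprimality *)

Lemma map_horner_eq0 (K : fieldType) (a : K) (P : {poly {poly K}}) :
  map_poly (horner_eval a) P = 0 -> exists Q, P = ('X - a%:P) *: Q.
Proof.
move=> P0; exists (\poly_(i < size P) (P`_i %/ ('X - a%:P))).
apply/polyP => i; rewrite coefZ coef_poly; case: ltnP => [_|?].
  rewrite mulrC divpK // dvdp_XsubCl; apply/rootP.
  by have := congr1 (fun p : {poly K} => p`_i) P0; rewrite coef_map coef0.
by rewrite mulr0 nth_default.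
Qed.

(** A form of Gauss's lemma.  A root [a] of the denominator [c] makes the
    product [A * B] vanish at x = a, so one of the two factors is divisible by
    x - a, which can be cancelled; induct on the degree of [c]. *)
Lemma gauss_factor (K : closedFieldType) (c : {poly K})
    (F A B : {poly {poly K}}) : c != 0 -> c *: F = A * B ->
  exists u v A' B', [/\ A = u *: A', B = v *: B' & F = A' * B'].
Proof.
have [n] := ubnP (size c); elim: n => // n IHn in c A B *.
rewrite ltnS => szc c0 eAB.
have [/eqP/size_poly1P[k k0 ck]|nonconst_c] := eqVneq (size c) 1.
  exists c, 1, (k^-1%:P *: A), B; split; rewrite ?scale1r //.
    by rewrite scalerA ck -polyCM divff // scale1r.
  by rewrite -scalerAl -eAB scalerA ck -polyCM mulVf // scale1r.
have [a /factor_theorem[c' ec]] := closed_rootP _ nonconst_c.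
have c'0 : c' != 0 by apply: contraNneq c0 => e; rewrite ec e mul0r.
have szc' : (size c' < n)%N.
  by move: szc; rewrite ec size_Mmonic ?monicXsubC // size_XsubC addn2.
have cancel (P Q : {poly {poly K}}) :
    ('X - a%:P) *: P = ('X - a%:P) *: Q -> P = Q.
  rewrite -!mul_polyC; apply: mulfI.
  by rewrite polyC_eq0 polyXsubC_eq0.
have /eqP : map_poly (horner_eval a) (A * B) = 0.
  rewrite -eAB ec -mul_polyC polyCM !rmorphM /= [X in _ * X * _]map_polyC /=.
  by rewrite /horner_eval hornerXsubC subrr mulr0 mul0r.
rewrite rmorphM mulf_eq0 => /orP[]/eqP/map_horner_eq0[Q eQ].
  have [|u [v [A' [B' [eA eB eF]]]]] := IHn c' Q B szc' c'0.
    by apply: cancel; rewrite scalerA mulrC -ec eAB eQ scalerAl.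
  by exists (('X - a%:P) * u), v, A', B'; rewrite eQ eA scalerA.
have [|u [v [A' [B' [eA eB eF]]]]] := IHn c' A Q szc' c'0.
  by apply: cancel; rewrite scalerA mulrC -ec eAB eQ scalerAr.
by exists u, (('X - a%:P) * v), A', B'; rewrite eQ eB scalerA.
Qed.

(** Divisibility of polynomials over a domain is up to scalars of K[x], which
    [gauss_factor] removes before irreducibility in K[x][y] is applied. *)
Lemma dvdp_irreducible (K : closedFieldType) (F h : {poly {poly K}}) :
  F \is monic -> irreducible_elt F -> h %| F -> (1 < size h)%N ->
  exists w, h = w *: F.
Proof.
move=> monF [_ _ irrF] /Pdiv.Idomain.dvdpP[[c q] /= c0 e] szh.
have [u [v [q' [h' [_ eh eF]]]]] := gauss_factor c0 e.
have szh' : (1 < size h')%N by rewrite (leq_trans szh) // eh size_scale_leq.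
have [|] := irrF _ _ eF; last first.
  by rewrite poly_unitE; case: eqP szh' => // ->.
rewrite poly_unitE => /andP[/eqP/eq_leq/size1_polyC eq' q'U].
exists (v * (q'`_0)^-1).
by rewrite eF {2}eq' mul_polyC scalerA mulrVK.
Qed.

Lemma irreducible_coprime (K : closedFieldType) (F G : {poly {poly K}}) :
  F \is monic -> irreducible_elt F -> G \is monic -> irreducible_elt G ->
  F != G -> (size (gcdp F G) <= 1)%N.
Proof.
move=> monF irrF monG irrG; rewrite leqNgt; apply: contraNN => szd.
have [w ew] := dvdp_irreducible monF irrF (dvdp_gcdl F G) szd.
have [v ev] := dvdp_irreducible monG irrG (dvdp_gcdr F G) szd.
have d0 : gcdp F G != 0 by rewrite -size_poly_gt0 (ltn_trans _ szd).
have ewv : w = v.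
  have /(congr1 lead_coef) : w *: F = v *: G by rewrite -ew.
  by rewrite !lead_coefZ (monicP monF) (monicP monG) !mulr1.
have w0 : w%:P != 0.
  by rewrite polyC_eq0; apply: contraNneq d0 => w0; rewrite ew w0 scale0r.
by apply/eqP/(mulfI w0); rewrite !mul_polyC -ew ewv.
Qed.

Lemma resultant_neq0 (K : closedFieldType) (F G : {poly {poly K}}) :
  F \is monic -> (1 < size F)%N -> irreducible_elt F ->
  G \is monic -> (1 < size G)%N -> irreducible_elt G ->
  F != G -> \det (mulmod_mx F G) != 0.
Proof.
move=> monF szF irrF monG szG irrG FG.
have [[u v] /= _ e] := resultant_in_ideal szF szG.
apply: det_mulmod_coprime e; rewrite // resultant_eq0 -leqNgt.
exact: irreducible_coprime.
Qed.

(** * Cofactors of invariant curves *)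

Lemma coef_lienard_opS (K : comNzRingType) (f g : {poly K}) P j :
  (lienard_op f g P)`_j.+1
    = (P`_j)^`() - (f * P`_j.+1 *+ j.+1 + g * P`_j.+2 *+ j.+2).
Proof.
rewrite /lienard_op coefB coefXM /= coef_map /= mulrDl coefD -mulrA !coefCM.
by rewrite coefXM /= !coef_deriv !mulrnAr.
Qed.

(** The coefficient of y^(N+1), with N the degree in y, reads mu' = l1 mu, where
    mu is the leading coefficient of [F] and l1 the coefficient of y in the
    cofactor.  Since mu' has lower degree than mu, both mu' and l1 vanish. *)
Lemma monic_representative (K : numFieldType) (f g : {poly K})
  (F : {poly {poly K}}) : invariant_curve f g F -> irreducible_elt F ->
  exists c F0 l, [/\ c != 0, F = c%:P%:P * F0,
    [/\ F0 \is monic, (1 < size F0)%N & irreducible_elt F0] &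
    lienard_op f g F0 = l%:P * F0].
Proof.
move=> [ncF [lam /[dup] invF]]; rewrite -/(lienard_op f g F) => eF [F0 F1 F2].
pose N := (size F).-1.
have szF : size F = N.+1 by rewrite prednK // size_poly_gt0.
have FN : F`_N != 0 by rewrite -[F`_N]/(lead_coef F) lead_coef_eq0.
have Fd j : (N < j)%N -> F`_j = 0.
  by move=> lt_Nj; rewrite nth_default // szF.
have szlam : (size lam <= 2)%N.
  have [->|lam0] := eqVneq lam 0; first by rewrite size_poly0.
  have : (size (lienard_op f g F) <= N.+2)%N.
    apply/leq_sizeP => -[//|j] /= ltj; rewrite coef_lienard_opS !Fd //; try lia.
    by rewrite linear0 !mulr0 !mul0rn addr0 subr0.
  by rewrite eF size_mul // szF addnS /= addnC -[N.+2]addn2 leq_add2l.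
have top : (F`_N)^`() = lam`_1 * F`_N.
  have := congr1 (fun P : {poly {poly K}} => P`_(N.+1)) eF.
  rewrite coef_lienard_opS (Fd N.+1) // (Fd N.+2) //.
  rewrite !mulr0 !mul0rn addr0 subr0 => ->.
  have /(congr1 (fun P => (P * F)`_(N.+1))) :
      lam = (lam`_0)%:P + (lam`_1)%:P * 'X.
    apply/polyP => -[|[|j]]; rewrite coefD coefC coefMX coefC ?addr0 ?add0r //.
    by rewrite nth_default // (leq_trans szlam).
  move=> ->; rewrite mulrDl -mulrA coefD !coefCM coefXM /= (Fd N.+1) //.
  by rewrite mulr0 add0r.
have lam1 : lam`_1 = 0.
  apply: contraTeq (lt_size_deriv FN) => l0.
  rewrite top size_mul // -leqNgt; move: l0; rewrite -size_poly_gt0.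
  by case: (size lam`_1) => // n _; rewrite addSn leq_addl.
have elam : lam = (lam`_0)%:P.
  apply: size1_polyC; apply/leq_sizeP => -[|[|j]] // _.
  by rewrite nth_default // (leq_trans szlam).
have [c c0 ec] : exists2 c, c != 0 & F`_N = c%:P.
  move: top; rewrite lam1 mul0r => dF.
  have e : F`_N = ((F`_N)`_0)%:P.
    apply: size1_polyC; move: (size_deriv F`_N).
    by rewrite dF size_poly0; case: (size F`_N) => [|[]].
  by exists ((F`_N)`_0) => //; move: FN; rewrite {1}e polyC_eq0.
have U : c^-1%:P%:P \is a @GRing.unit {poly {poly K}}.
  rewrite !(poly_unitE, size_polyC, coefC) /= !polyC_eq0 invr_eq0 c0.
  by rewrite unitfE invr_eq0.
have eF0 : F = c%:P%:P * (c^-1%:P%:P * F).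
  by rewrite mulrA -!polyCM divff // mul1r.
exists c, (c^-1%:P%:P * F), (lam`_0); split => //.
- have szF0 : size (c^-1%:P%:P * F) = N.+1.
    by rewrite mul_polyC size_scale ?szF // polyC_eq0 invr_eq0.
  split.
  + by rewrite monicE lead_coefE szF0 coefCM ec -polyCM mulVf.
  + rewrite szF0 ltnS lt0n; apply/eqP => N0; apply: (ncF c).
    by rewrite -ec N0; apply: size1_polyC; rewrite szF N0.
  + split.
    * by rewrite -size_poly_gt0 szF0.
    * by rewrite unitrMr.
    * move=> p q e; have [|pU|qU] := F2 (c%:P%:P * p) q.
      - by rewrite -mulrA -e.
      - left; have -> : p = c^-1%:P%:P * (c%:P%:P * p).
          by rewrite mulrA -!polyCM mulVf // mul1r.
        by rewrite unitrMr.
      - by right.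
- rewrite lienard_opM lienard_opC derivC mulr0 mul0r add0r eF elam coefC /=.
  by rewrite mulrCA.
Qed.

(** If y divided [F] then, since g <> 0, the coefficient of y would vanish as
    well, so that y^2 would divide [F]. *)
Lemma coef0_neq0 (K : idomainType) (f g l : {poly K}) (F : {poly {poly K}}) :
  g != 0 -> irreducible_elt F ->
  lienard_op f g F = l%:P * F -> F`_0 != 0.
Proof.
move=> g0 [F0 _ irrF] eF; apply/eqP => F00.
have ec : l * F`_0 = - (g * F`_1).
  have := congr1 (fun P : {poly {poly K}} => P`_0) eF.
  by rewrite coefCM coef0_lienard_op => <-.
have F10 : F`_1 = 0.
  apply/eqP; have /eqP := ec.
  by rewrite F00 mulr0 eq_sym oppr_eq0 mulf_eq0 (negPf g0).
have e : F = 'X * ('X * \poly_(i < size F) F`_i.+2).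
  apply/polyP => -[|[|j]]; rewrite !coefXM //= coef_poly.
  by case: ltnP => // ?; rewrite nth_default //; lia.
have XU (p : {poly {poly K}}) : 'X * p \is a GRing.unit -> False.
  by rewrite poly_unitE coefXM /= unitr0 andbF.
by case: (irrF _ _ e) => [|/XU//]; rewrite -['X]mulr1 => /XU.
Qed.

(** * Degrees of cofactors *)

(** If deg l < deg f then the factor f (j + 1) + l in the recurrence for the
    coefficients of [F] has degree deg f, and its term dominates the one in g
    because deg g < 2 deg f + 1.  So the coefficient of y^(N-i) has degree
    exactly i (deg f + 1), and the equation l F_0 = - g F_1 gives deg l. *)
Lemma cofactor_size_cases (K : numFieldType) (f g l : {poly K})
    (F : {poly {poly K}}) :
  f != 0 -> g != 0 -> (size g < (size f).*2)%N ->
  F \is monic -> (1 < size F)%N -> lienard_op f g F = l%:P * F ->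
  (size f <= size l)%N \/ (size l + size f = size g)%N.
Proof.
move=> f0 g0 szg monF szF eF.
have [|szl] := leqP (size f) (size l); [by left | right].
pose N := (size F).-1; have N1 : (0 < N)%N by rewrite /N; lia.
pose a k : {poly K} := F`_k.
have rec j : (a j)^`() = (f *+ j.+1 + l) * a j.+1 + g *+ j.+2 * a j.+2.
  have := congr1 (fun P : {poly {poly K}} => P`_(j.+1)) eF.
  rewrite /= coefCM coef_lienard_opS => /(canRL (subrK _)) ->.
  by rewrite mulrDl !mulrnAl addrA [l * _ + _]addrC.
have ec : l * a 0%N = - (g * a 1%N).
  have := congr1 (fun P : {poly {poly K}} => P`_0) eF.
  by rewrite coefCM coef0_lienard_op => <-.
have szMn (p : {poly K}) k : size (p *+ k.+1) = size p.
  by rewrite -scaler_nat size_scale // pnatr_eq0.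
have szfl j : size (f *+ j.+1 + l) = size f.
  by rewrite size_polyDl szMn.
(* The recurrence has order two, so two consecutive sizes are carried along.
   At i = 0 the bound with i.-1 = 0 would be too weak for the next step; there
   the coefficient above the leading one vanishes. *)
have key i : (i <= N)%N ->
    (size (a (N - i)) = (i * size f).+1)%N /\
    (size (a (N - i).+1) <= (i.-1 * size f).+1)%N /\
    (i = 0%N -> (a (N - i).+1) = 0).
  elim: i => [|i IHi] ltiN.
    rewrite subn0 -[a N]/(lead_coef F) (monicP monF) size_poly1 mul0n.
    by rewrite /a nth_default ?size_poly0 ?leqSpred.
  have [sz1 [sz2 z2]] := IHi (ltnW ltiN).
  have ej : (N - i)%N = (N - i.+1).+1 by lia.
  rewrite ej in sz1 sz2 z2; set j := (N - i.+1)%N in sz1 sz2 z2 *.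
  split; last by rewrite sz1.
  have a0 : a j.+1 != 0 by rewrite -size_poly_gt0 sz1.
  have h0 : f *+ j.+1 + l != 0 by rewrite -size_poly_gt0 szfl size_poly_gt0.
  have s1 : size ((f *+ j.+1 + l) * a j.+1) = (size f + i * size f)%N.
    by apply/eqP; rewrite -eqSS size_mulS // szfl sz1 addnS.
  pose q := g *+ j.+2 * a j.+2.
  have s2 : (size q < size f + i * size f)%N.
    rewrite /q; have [b0|b0] := eqVneq (a j.+2) 0.
      by rewrite b0 mulr0 size_poly0 addn_gt0 size_poly_gt0 f0.
    have i0 : i != 0%N by apply: contraNneq b0 => /z2/eqP.
    have gj0 : g *+ j.+2 != 0 by rewrite -scaler_nat scaler_eq0 pnatr_eq0.
    rewrite -ltnS size_mulS // szMn.
    have -> : (i * size f = size f + i.-1 * size f)%N.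
      by rewrite -mulSn prednK // lt0n.
    by move: sz2 szg; rewrite -addnn; move: (_ * _)%N => k; lia.
  have := size_deriv (a j); rewrite rec size_polyDl s1 // mulSn.
  by move: f0; rewrite -size_poly_gt0; lia.
have [s0 _] := key N (leqnn N); rewrite subnn in s0.
have [s1 _] := key N.-1 (leq_pred N).
rewrite -subn1 subKn // in s1.
have a1 : a 1%N != 0 by rewrite -size_poly_gt0 s1.
have a0 : a 0%N != 0 by rewrite -size_poly_gt0 s0.
have l0 : l != 0.
  apply: contraTneq (mulf_neq0 g0 a1) => l0.
  by rewrite -[g * _]opprK -ec l0 mul0r oppr0 eqxx.
have := congr1 (fun p : {poly K} => (size p).+1) ec.
rewrite size_polyN !size_mulS // s0 s1.
have -> : (N = (N - 1).+1)%N by lia.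
rewrite mulSn subn1 /=; lia.
Qed.

(** Here r' <> 0, so [r] is not constant and r' has degree one less. *)
Lemma cofactor_size_add (K : numFieldType) (g lF lG r : {poly K}) :
  g != 0 -> lF != 0 -> lG != 0 -> r != 0 -> g * r^`() = lF * lG * r ->
  (size lF + size lG)%N = size g.
Proof.
move=> g0 lF0 lG0 r0 e.
have l0 : lF * lG != 0 by rewrite mulf_neq0.
have r'0 : r^`() != 0.
  by apply: contraNneq (mulf_neq0 l0 r0) => r'0; rewrite -e r'0 mulr0.
have := congr1 (fun p : {poly K} => (size p).+2) e.
rewrite size_mulS // [in RHS]size_mulS // size_deriv.
have r1 : (0 < (size r).-1)%N by rewrite -size_deriv size_poly_gt0.
by have := size_mulS lF0 lG0; lia.
Qed.

(** * At most two curves *)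

Lemma cofactor_size_pair (K : numClosedFieldType) (f g lF lG : {poly K})
    (F G : {poly {poly K}}) :
  g != 0 -> lF != 0 -> lG != 0 ->
  F \is monic -> (1 < size F)%N -> irreducible_elt F ->
  G \is monic -> (1 < size G)%N -> irreducible_elt G ->
  lienard_op f g F = lF%:P * F -> lienard_op f g G = lG%:P * G ->
  F != G -> (size lF + size lG)%N = size g.
Proof.
move=> g0 lF0 lG0 monF szF irrF monG szG irrG eF eG FG.
have r0 := resultant_neq0 monF szF irrF monG szG irrG FG.
have F0 := coef0_neq0 g0 irrF eF.
exact: cofactor_size_add g0 lF0 lG0 r0 (resultant_ode monF F0 eF eG).
Qed.

Lemma pred_bounds (m n : nat) : (0 < m)%N -> (m.-1 < n.-1)%N ->
  (n.-1 < 2 * m.-1 + 1)%N -> (m < n)%N /\ (n < m.*2)%N.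
Proof. by rewrite -addnn; lia. Qed.

Lemma sizes_incompatible (m n x y z : nat) :
  (m < n)%N -> (n < m.*2)%N ->
  (m <= x)%N \/ (x + m = n)%N -> (m <= y)%N \/ (y + m = n)%N ->
  (m <= z)%N \/ (z + m = n)%N ->
  (x + y)%N = n -> (x + z)%N = n -> (y + z)%N = n -> False.
Proof. by rewrite -addnn; lia. Qed.

Theorem theorem3p3 (R : realType) (f g : {poly R[i]})
  (f_neq0 : f != 0) (g_neq0 : g != 0)
  (deg_fg : (deg f < deg g)%N) (deg_gf : (deg g < 2 * deg f + 1)%N)
  (F1 F2 F3 : {poly {poly R[i]}})
  (hF1 : irreducible_invariant_curve f g F1)
  (hF2 : irreducible_invariant_curve f g F2)
  (hF3 : irreducible_invariant_curve f g F3) :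
  [\/ same_curve F1 F2, same_curve F1 F3 | same_curve F2 F3].
Proof.
have [inv1 irr1] := hF1; have [inv2 irr2] := hF2; have [inv3 irr3] := hF3.
have [c1 [G1 [l1 [c1_0 -> [mon1 sz1 {}irr1] e1]]]]
  := monic_representative inv1 irr1.
have [c2 [G2 [l2 [c2_0 -> [mon2 sz2 {}irr2] e2]]]]
  := monic_representative inv2 irr2.
have [c3 [G3 [l3 [c3_0 -> [mon3 sz3 {}irr3] e3]]]]
  := monic_representative inv3 irr3.
have same (c c' : R[i]) (G : {poly {poly R[i]}}) : c != 0 -> c' != 0 ->
    same_curve (c%:P%:P * G) (c'%:P%:P * G).
  move=> c0 c'0; exists (c / c'); first by rewrite mulf_neq0 ?invr_eq0.
  by rewrite mulrA -!polyCM divfK.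
have [->|G12] := eqVneq G1 G2; first by constructor 1; apply: same.
have [->|G13] := eqVneq G1 G3; first by constructor 2; apply: same.
have [->|G23] := eqVneq G2 G3; first by constructor 3; apply: same.
have szf : (0 < size f)%N by rewrite size_poly_gt0.
have [szfg szgf] := pred_bounds szf deg_fg deg_gf.
have d1 := cofactor_size_cases f_neq0 g_neq0 szgf mon1 sz1 e1.
have d2 := cofactor_size_cases f_neq0 g_neq0 szgf mon2 sz2 e2.
have d3 := cofactor_size_cases f_neq0 g_neq0 szgf mon3 sz3 e3.
have nz (l : {poly R[i]}) :
    (size f <= size l)%N \/ (size l + size f)%N = size g -> l != 0.
  move=> d; apply/eqP => l0; move: d; rewrite l0 size_poly0 leqn0 add0n.
  by rewrite size_poly_eq0 (negPf f_neq0) => -[//|e]; rewrite e ltnn in szfg.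
have [l1_0 l2_0 l3_0] := And3 (nz _ d1) (nz _ d2) (nz _ d3).
have s12 := cofactor_size_pair g_neq0 l1_0 l2_0
  mon1 sz1 irr1 mon2 sz2 irr2 e1 e2 G12.
have s13 := cofactor_size_pair g_neq0 l1_0 l3_0
  mon1 sz1 irr1 mon3 sz3 irr3 e1 e3 G13.
have s23 := cofactor_size_pair g_neq0 l2_0 l3_0
  mon2 sz2 irr2 mon3 sz3 irr3 e2 e3 G23.
by case: (sizes_incompatible szfg szgf d1 d2 d3 s12 s13 s23).
Qed.
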